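(* Let $k \geq 2$ and let $G$ be a $k$-critical graph with $\chi_{DP}(G) = k$. Let $l \geq 2$ and $$c_{k,l} = \left\lceil \frac{l\ln(k+l-1)}{\ln((k-1)!)+l\ln(k+l-1)-\ln\big((k-1)!(k+l-1)^{l}-(k+l-1)!\big)} \right\rceil.$$ Then $\chi_{DP}(G \square K_{l,t}) = k+l$ for every $t\in\mathbb{N}$ with $t \geq c_{k,l}\left(\frac{P(G,k+l-1)}{k+l-1}\right)^l$. Consequently, $\chi_{DP}(G \square K_{l,t}) = k+l$ for every $t\in\mathbb{N}$ with $t \geq \left(\frac{l(k-1)!\ln(k+l-1)}{(k+l-1)!}\right)(P(G,k+l-1))^l$.
   Context: All graphs are finite, simple and nonempty. A DP-cover of $G$ is a pair $\mathcal{H}=(L,H)$ where $H$ is a graph and $L$ assigns to each $v\in V(G)$ a set $L(v)\subseteq V(H)$ such that the $L(v)$ are pairwise disjoint independent sets of $H$ with union $V(H)$, and for $u\neq v$, if there is an edge of $H$ between $L(u)$ and $L(v)$ then $uv\in E(G)$ and these edges form a matching. $\mathcal{H}$ is $k$-fold if $|L(v)|=k$ for all $v$. An $\mathcal{H}$-coloring is an independent set $I$ of $H$ with $|I\cap L(v)|=1$ for all $v$. $\chi_{DP}(G)$ is the least $k$ such that every $k$-fold cover of $G$ admits an $\mathcal{H}$-coloring. $P(G,m)$ is the chromatic polynomial (number of proper colorings $V(G)\to[m]$). A graph is $k$-critical if its chromatic number is $k$ and every proper subgraph has smaller chromatic number. $G\square H$ is the Cartesian product (vertex set $V(G)\times V(H)$,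 $(u,v)\sim(u',v')$ iff $u=u'$ and $vv'\in E(H)$, or $v=v'$ and $uu'\in E(G)$); $K_{l,t}$ is the complete bipartite graph with parts of sizes $l$ and $t$. *)

(* Defs.v *)
From HB Require Import structures.
From mathcomp Require Import all_boot all_order all_algebra.
From mathcomp Require Import boolp reals exp.

Set Implicit Arguments.
Unset Strict Implicit.
Unset Printing Implicit Defensive.

Declare Scope graph_scope.

(* Nonemptiness is not part of the structure: the graph H of a 0-fold cover has
   no vertices. *)
Record sgraph := SGraph {
  svertex :> finType;
  sedge : rel svertex;
  sedge_sym : symmetric sedge;
  sedge_irrefl : irreflexive sedge }.

Notation "x -- y" := (sedge x y) (at level 30, no associativity).

Section Coloring.
Variable G : sgraph.

Definition independent (I : {set G}) : bool :=
  [forall x in I, forall y in I, ~~ (x -- y)].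

Definition proper_coloring (m : nat) (f : {ffun G -> 'I_m}) : bool :=
  [forall x, forall y, (x -- y) ==> (f x != f y)].

Definition chrom_poly (m : nat) : nat :=
  #|[set f : {ffun G -> 'I_m} | proper_coloring f]|.

Definition colorable (m : nat) : bool :=
  [exists f : {ffun G -> 'I_m}, proper_coloring f].

Lemma colorable_exists : exists m, colorable m.
Proof.
exists #|G|; apply/existsP; exists [ffun x => enum_rank x].
apply/forallP=> x; apply/forallP=> y; apply/implyP=> xy.
rewrite !ffunE; apply/eqP=> /enum_rank_inj exy.
by rewrite exy sedge_irrefl in xy.
Qed.

Definition chi : nat := ex_minn colorable_exists.

End Coloring.

Record subgraph (G : sgraph) := SubGraph {
  sub_verts : {set G};
  sub_edge : rel G;
  sub_edge_sym : symmetric sub_edge;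
  sub_edge_sub : forall x y, sub_edge x y -> x -- y;
  sub_edge_verts : forall x y, sub_edge x y -> (x \in sub_verts) && (y \in sub_verts) }.

Section SubgraphGraph.
Variables (G : sgraph) (S : subgraph G).

Definition sg_of_sub_rel : rel {x : G | x \in sub_verts S} :=
  fun x y => sub_edge S (val x) (val y).

Lemma sg_of_sub_sym : symmetric sg_of_sub_rel.
Proof. by move=> x y; apply: sub_edge_sym. Qed.

Lemma sg_of_sub_irrefl : irreflexive sg_of_sub_rel.
Proof.
by move=> x; apply/negP=> /(@sub_edge_sub _ S); rewrite sedge_irrefl.
Qed.

Definition sg_of_sub : sgraph := SGraph sg_of_sub_sym sg_of_sub_irrefl.

Definition proper_subgraph : Prop :=
  sub_verts S <> [set: G] \/ exists x y : G, x -- y /\ ~~ sub_edge S x y.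

End SubgraphGraph.

Definition critical (k : nat) (G : sgraph) : Prop :=
  chi G = k /\
  forall S : subgraph G, proper_subgraph S -> chi (sg_of_sub S) < k.

Definition edges_between (H : sgraph) (A B : {set H}) : {set {set H}} :=
  [set [set p.1; p.2] | p in [set p : H * H | [&& p.1 \in A, p.2 \in B & p.1 -- p.2]]].

(* trivIset: two distinct edges of M are disjoint *)
Definition matching (H : sgraph) (M : {set {set H}}) : bool := trivIset M.

Record dp_cover (G : sgraph) := DPCover {
  cov_graph :> sgraph;
  cov_list : G -> {set cov_graph};
  cov_disjoint : forall u v, u != v -> [disjoint cov_list u & cov_list v];
  cov_independent : forall v, independent (cov_list v);
  cov_union : \bigcup_v cov_list v = [set: cov_graph];
  cov_edge : forall u v, u != v ->
    edges_between (cov_list u) (cov_list v) != set0 -> u -- v;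
  cov_matching : forall u v, u != v ->
    matching (edges_between (cov_list u) (cov_list v)) }.

Definition fold_cover (G : sgraph) (k : nat) (H : dp_cover G) : Prop :=
  forall v : G, #|cov_list H v| = k.

Definition cover_coloring (G : sgraph) (H : dp_cover G) (I : {set H}) : Prop :=
  independent I /\ forall v : G, #|I :&: cov_list H v| = 1.

Definition dp_colorable (G : sgraph) (k : nat) : Prop :=
  forall H : dp_cover G, fold_cover k H -> exists I : {set H}, cover_coloring I.

Section DPExists.
Variables (G : sgraph) (H : dp_cover G).
Hypothesis Hfold : fold_cover #|G| H.
Local Notation L := (cov_list H).

Lemma cover_nbr_le1 (u v : G) (x : H) : u != v -> x \in L u ->
  #|[set y in L v | x -- y]| <= 1.
Proof.
move=> uv xu; apply/card_le1_eqP=> y z.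
rewrite !inE => /andP[yv xy] /andP[zv xz].
have inE_ w : w \in L v -> x -- w -> [set x; w] \in edges_between (L u) (L v).
  by move=> wv xw; apply/imsetP; exists (x, w); rewrite // inE /= xu wv xw.
have /trivIsetP tr := @cov_matching _ H _ _ uv.
have [e|ne] := eqVneq [set x; y] [set x; z].
  have : y \in [set x; z] by rewrite -e !inE eqxx orbT.
  rewrite !inE => /orP[/eqP yx|/eqP//].
  by move: xy; rewrite yx sedge_irrefl.
have := tr _ _ (inE_ _ yv xy) (inE_ _ zv xz) ne.
by move=> /pred0P/(_ x); rewrite /= !inE eqxx.
Qed.

Lemma greedy_transversal (s : seq G) : uniq s ->
  exists f : G -> option H,
    (forall u, u \in s -> exists2 x, f u = Some x & x \in L u) /\
    (forall u v x y, u \in s -> v \in s -> f u = Some x -> f v = Some y -> ~~ (x -- y)).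
Proof.
elim: s => [|v s IH] /=; first by move=> _; exists (fun _ => None).
move=> /andP[vs us]; have [f [fL fI]] := IH us.
pose B u := if f u is Some x then [set y in L v | x -- y] else set0.
have cardB : #|\bigcup_(u <- s) B u| <= size s.
  elim: s vs us {IH fI} fL => [|w s IH] /=; first by rewrite big_nil cards0.
  rewrite inE negb_or => /andP[vw vs] /andP[_ us] fL.
  rewrite big_cons; apply: leq_trans (leq_card_setU _ _) _.
  rewrite -[(size s).+1]add1n; apply: leq_add; last first.
    by apply: IH => // u us'; apply: fL; rewrite inE us' orbT.
  have [x fx xw] := fL w (mem_head _ _).
  by rewrite /B fx; apply: cover_nbr_le1 xw; rewrite eq_sym.
have szs : size s < #|G|.
  have := max_card (mem (v :: s)).
  by rewrite (card_uniqP _) //= vs us.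
have [x xv xB] : exists2 x, x \in L v & x \notin \bigcup_(u <- s) B u.
  apply/subsetPn; apply/negP=> /subset_leq_card.
  by rewrite Hfold leqNgt (leq_ltn_trans cardB szs).
have xN u z : u \in s -> f u = Some z -> ~~ (z -- x).
  move=> us' fz; apply: contra xB => zx.
  rewrite (big_rem u us') /= inE; apply/orP; left.
  by rewrite /B fz inE xv zx.
exists (fun u => if u == v then Some x else f u); split.
  move=> u; rewrite inE; case: eqP => [->|_] /=; first by exists x.
  exact: fL.
move=> u w a b; rewrite !inE.
case: eqP => [_|_] /=; case: eqP => [_|_] //=.
- by move=> _ _ [<-] [<-]; rewrite sedge_irrefl.
- by move=> _ ws [<-] fb; rewrite sedge_sym; apply: xN fb.
- by move=> us' _ fa [<-]; apply: xN fa.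
- exact: fI.
Qed.

End DPExists.

Lemma dp_colorable_exists (G : sgraph) : exists k, `[< dp_colorable G k >].
Proof.
exists #|G|; apply/asboolP=> H Hfold.
have [f [fL fI]] := greedy_transversal Hfold (enum_uniq G).
exists [set x | [exists u, f u == Some x]]; split.
  apply/forallP=> x; apply/implyP; rewrite inE => /existsP[u /eqP fu].
  apply/forallP=> y; apply/implyP; rewrite inE => /existsP[v /eqP fv].
  by apply: fI fu fv; rewrite mem_enum.
move=> v; have [x fx xv] := fL v (mem_enum _ _).
rewrite (_ : _ :&: _ = [set x]) ?cards1 //.
apply/setP=> y; rewrite !inE; apply/andP/eqP => [[/existsP[u /eqP fu] yv]|->].
  have [uv|uv] := eqVneq u v; first by move: fu; rewrite uv fx => -[].
  have [z fz zu] := fL u (mem_enum _ _).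
  move: fz zu; rewrite fu => -[<-] yu.
  by have /pred0P/(_ y) := @cov_disjoint _ H _ _ uv; rewrite /= yu yv.
by split=> //; apply/existsP; exists v; apply/eqP.
Qed.

Definition chi_DP (G : sgraph) : nat := ex_minn (dp_colorable_exists G).

Section CartesianProduct.
Variables G H : sgraph.

Definition cart_rel : rel (G * H) := fun p q =>
  ((p.1 == q.1) && (p.2 -- q.2)) || ((p.2 == q.2) && (p.1 -- q.1)).

Lemma cart_sym : symmetric cart_rel.
Proof.
move=> p q; rewrite /cart_rel [p.1 == _]eq_sym [p.2 == _]eq_sym.
by rewrite [p.2 -- _]sedge_sym [p.1 -- _]sedge_sym.
Qed.

Lemma cart_irrefl : irreflexive cart_rel.
Proof. by move=> p; rewrite /cart_rel !sedge_irrefl !andbF. Qed.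

Definition cart_prod : sgraph := SGraph cart_sym cart_irrefl.

End CartesianProduct.

Notation "G □ H" := (cart_prod G H) (at level 40, left associativity) : graph_scope.

Section CompleteBipartite.
Variables l t : nat.

Definition bip_rel : rel ('I_l + 'I_t) := fun x y =>
  match x, y with
  | inl _, inr _ | inr _, inl _ => true
  | _, _ => false
  end.

Lemma bip_sym : symmetric bip_rel. Proof. by case=> ? []. Qed.
Lemma bip_irrefl : irreflexive bip_rel. Proof. by case. Qed.

Definition complete_bipartite : sgraph := SGraph bip_sym bip_irrefl.

End CompleteBipartite.

Notation "''K_' ( l , t )" := (complete_bipartite l t)
  (at level 8, format "''K_' ( l ,  t )") : graph_scope.

Import GRing.Theory.
Local Open Scope ring_scope.

Definition c_kl (R : realType) (k l : nat) : int :=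
  let lnkl : R := l%:R * ln (k + l - 1)%:R in
  Num.ceil (lnkl /
    (ln ((k - 1)`!)%:R + lnkl
     - ln (((k - 1)`!)%:R * (k + l - 1)%:R ^+ l - ((k + l - 1)`!)%:R))).

(* Main.v *)
(* Write m = k + l - 1.  The bound chi_DP <= k + l is greedy: colour the l left
   copies of G from their own lists, after which every vertex of a right copy
   has lost at most l colours and still has k.

   For the lower bound, take lists Z_m and let every matching be a translation,
   trivial inside each copy of G.  A colouring of the left copies is an l-tuple of
   proper m-colourings f_i = g_i + a_i with g_i vanishing at a base vertex u0, so
   there are (P(G,m)/m)^l tuples g.  A right copy labelled (g, s), joined to the
   i-th left copy by the translation s_i - g_i(u) at u, loses at every vertex the
   same set {a_i + s_i}; if these l colours are distinct, only k - 1 colours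
   remain for this copy and it cannot be coloured.  So for each g one needs c
   labels s such that every a in Z_m^l has some a + s with distinct coordinates.
   Choosing them greedily leaves at most m^l (1 - q)^c <= 1 tuples a uncaught,
   where q is the proportion of injective tuples, and since the uncaught set is
   invariant under adding constants, it is empty.

   The second bound follows from ln y >= 2 (y - 1) / (y + 1): it makes
   l ln(m) / q exceed l ln(m) / (- ln (1 - q)) by at least l ln(m) / 2 >= 1, which
   absorbs the ceiling. *)
Require Import Defs.
From HB Require Import structures.
From mathcomp Require Import normedtype derive.
From mathcomp Require Import all_boot all_order all_algebra.
From mathcomp Require Import boolp reals exp.
From mathcomp Require Import ring lra zify.

Local Open Scope ring_scope.
Local Open Scope graph_scope.

Set Implicit Arguments.
Unset Strict Implicit.
Unset Printing Implicit Defensive.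

Import Order.TTheory GRing.Theory Num.Theory.
Import numFieldNormedType.Exports.

(** * Covers presented by a projection onto the base graph *)

Section FiberCover.
Variables (G : sgraph) (V : finType) (e : rel V) (p : V -> G).
Hypothesis e_sym : symmetric e.
Hypothesis e_proj : forall x y, e x y -> p x -- p y.
Hypothesis e_inj : forall x y z, e x y -> e x z -> p y = p z -> y = z.

Lemma fiber_irrefl : irreflexive e.
Proof. by move=> x; apply/negP=> /e_proj; rewrite sedge_irrefl. Qed.

Definition fiber_graph : sgraph := SGraph e_sym fiber_irrefl.

Definition fiber (v : G) : {set fiber_graph} := [set x | p x == v].

Lemma fiber_disjoint u v : u != v -> [disjoint fiber u & fiber v].
Proof.
move=> uv; apply/pred0P=> x /=; rewrite !inE.
by case: eqP => //= ->; apply: negbTE.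
Qed.

Lemma fiber_independent v : independent (fiber v).
Proof.
apply/forall_inP=> x; rewrite inE => /eqP px.
apply/forall_inP=> y; rewrite inE => /eqP py.
by apply/negP=> /e_proj; rewrite px py sedge_irrefl.
Qed.

Lemma fiber_union : \bigcup_v fiber v = [set: fiber_graph].
Proof.
by apply/setP=> x; rewrite inE; apply/bigcupP; exists (p x); rewrite ?inE.
Qed.

Lemma fiber_edge u v : u != v -> edges_between (fiber u) (fiber v) != set0 -> u -- v.
Proof.
move=> _ /set0Pn[_ /imsetP[[x y] + _]]; rewrite !inE /=.
by case/and3P=> /eqP <- /eqP <- /e_proj.
Qed.

(** Two edges that meet share an endpoint over [u] or over [v], and [e_inj] then identifies their
    other ends; the mixed cases would put one point in two fibres. *)
Lemma fiber_matching u v : u != v -> matching (edges_between (fiber u) (fiber v)).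
Proof.
move=> uv; apply/trivIsetP.
move=> _ _ /imsetP[[x y] + ->] /imsetP[[x' y'] + ->]; rewrite !inE /=.
case/and3P=> /eqP px /eqP py xy /and3P[/eqP px' /eqP py' xy'].
apply: contraR => /pred0Pn[z /= /andP[]].
have yx : e y x by rewrite e_sym.
have yx' : e y' x' by rewrite e_sym.
rewrite !inE => /orP[] /eqP-> /orP[] /eqP E.
- by rewrite -{}E in xy' *; rewrite (e_inj xy xy') // py.
- by rewrite -px -py' E eqxx in uv.
- by rewrite -px' -py E eqxx in uv.
- by rewrite -{}E in yx' *; rewrite (e_inj yx yx') // px.
Qed.

Definition fiber_cover : dp_cover G :=
  DPCover fiber_disjoint fiber_independent fiber_union fiber_edge fiber_matching.

Lemma fiber_cover_coloring (I : {set fiber_cover}) : cover_coloring I ->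
  exists f : G -> V, (forall v, p (f v) = v) /\ (forall u v, ~~ e (f u) (f v)).
Proof.
case=> /forall_inP indI cardI.
have ex v : exists x : V, (x \in I :&: cov_list fiber_cover v).
  by apply/card_gt0P; rewrite cardI.
exists (fun v => xchoose (ex v)); split=> [v|u v].
  by have := xchooseP (ex v); rewrite !inE => /andP[_ /eqP].
have := xchooseP (ex u); have := xchooseP (ex v).
rewrite !inE => /andP[fv _] /andP[fu _].
by have /forall_inP := indI _ fu; apply.
Qed.

End FiberCover.

(** * Edges, transversals and sublists of an arbitrary cover *)

Section CoverFacts.
Variables (G : sgraph) (H : dp_cover G).
Implicit Types (u v : G) (x y z : H).

Lemma cov_list_inj u v x : x \in cov_list H u -> x \in cov_list H v -> u = v.
Proof.
move=> xu xv; apply/eqP; apply/negPn/negP=> /(@cov_disjoint _ H).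
by move/pred0P/(_ x); rewrite /= xu xv.
Qed.

Lemma cov_list_edge u v x y :
  x \in cov_list H u -> y \in cov_list H v -> x -- y -> u -- v.
Proof.
move=> xu yv xy; have [uv|uv] := eqVneq u v.
  have /forall_inP/(_ x xu)/forall_inP/(_ y) := @cov_independent _ H u.
  by rewrite {1}uv yv xy => /(_ isT).
apply: (@cov_edge _ H) => //; apply/set0Pn; exists [set x; y].
by apply/imsetP; exists (x, y); rewrite // inE /= xu yv xy.
Qed.

Lemma cov_list_nbr_inj u v x y z : x \in cov_list H u -> y \in cov_list H v ->
  z \in cov_list H v -> x -- y -> x -- z -> y = z.
Proof.
move=> xu yv zv xy xz; have [uv|uv] := eqVneq u v.
  by have := cov_list_edge xu yv xy; rewrite uv sedge_irrefl.
have /trivIsetP/(_ [set x; y] [set x; z]) := @cov_matching _ H _ _ uv.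
have inE_ w : w \in cov_list H v -> x -- w ->
    [set x; w] \in edges_between (cov_list H u) (cov_list H v).
  by move=> wv xw; apply/imsetP; exists (x, w); rewrite // inE /= xu wv xw.
have [exyz _|ne /(_ (inE_ _ yv xy) (inE_ _ zv xz) isT)] := eqVneq [set x; y] _.
  have : y \in [set x; z] by rewrite -exyz !inE eqxx orbT.
  rewrite !inE => /orP[/eqP yx|/eqP//].
  by move: xy; rewrite yx sedge_irrefl.
by move=> /pred0P/(_ x); rewrite /= !inE eqxx.
Qed.

Lemma transversal_coloring (F : G -> H) : (forall v, F v \in cov_list H v) ->
  (forall u v, ~~ (F u -- F v)) -> cover_coloring [set F v | v in [set: G]].
Proof.
move=> FL FI; split.
  apply/forall_inP=> _ /imsetP[u _ ->]; apply/forall_inP=> _ /imsetP[v _ ->].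
  exact: FI.
move=> v; rewrite (_ : _ :&: _ = [set F v]) ?cards1 //.
apply/setP=> x; rewrite !inE; apply/andP/eqP => [[/imsetP[u _ ->] Fuv]|->].
  by rewrite (cov_list_inj (FL u) Fuv).
by rewrite FL imset_f.
Qed.

End CoverFacts.

Section Restriction.
Variables (G Gam : sgraph) (H : dp_cover Gam) (phi : G -> Gam) (k : nat).
Variable A : G -> {set H}.
Hypothesis phiE : forall u v, phi u -- phi v -> u -- v.
Hypothesis A_sub : forall u, A u \subset cov_list H (phi u).
Hypothesis A_card : forall u, (k <= #|A u|)%N.
Hypothesis col_k : dp_colorable G k.

(** Each [A u] is trimmed to exactly [k] elements, and the edges of [H] between the trimmed sets,
    pulled back along [phi], form a [k]-fold cover of [G]. This serves to colour one copy of [G]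
    inside a product. *)
Lemma restricted_coloring :
  exists f : G -> H, (forall u, f u \in A u) /\ (forall u v, ~~ (f u -- f v)).
Proof.
pose B u := [set x in take k (enum (A u))].
have BA u : B u \subset A u.
  by apply/subsetP=> x; rewrite inE => /mem_take; rewrite mem_enum.
have cardB u : #|B u| = k.
  rewrite cardsE (card_uniqP _) ?take_uniq ?enum_uniq //.
  by rewrite size_takel // -cardE.
have BL u x : x \in B u -> x \in cov_list H (phi u).
  by move=> /(subsetP (BA u))/(subsetP (A_sub u)).
(* Pairs remember the base vertex, so the first component is a projection even where two sets [A u]
   meet. *)
pose V : finType := {z : G * H | z.2 \in B z.1}.
pose e : rel V := fun z w => (val z).2 -- (val w).2.
have e_sym : symmetric e by move=> z w; apply: sedge_sym.
have e_proj (z w : V) : e z w -> (val z).1 -- (val w).1.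
  move=> zw; apply: phiE.
  exact: cov_list_edge (BL _ _ (valP z)) (BL _ _ (valP w)) zw.
have e_inj (x y z : V) : e x y -> e x z -> (val y).1 = (val z).1 -> y = z.
  case: x y z => [[u x] /= xu] [[v y] /= yv] [[w z] /= zw].
  rewrite /e /= => xy xz vw; rewrite -{}vw in zw *.
  have yz := cov_list_nbr_inj (BL _ _ xu) (BL _ _ yv) (BL _ _ zw) xy xz.
  by apply: val_inj => /=; rewrite yz.
have foldK : fold_cover k (fiber_cover e_sym e_proj e_inj).
  move=> u; rewrite -(cardB u) /=.
  rewrite -(@card_in_imset _ _ (fun z : V => (val z).2)) => [|[[v x] xv] [[w y] yw]].
    apply: eq_card => x; apply/imsetP/idP => [[[[v y] /= yv]]|xu].
      by rewrite inE /= => /eqP <- ->.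
    by exists (Sub (u, x) xu); rewrite ?inE.
  rewrite !inE /= => /eqP vu /eqP wu xy.
  by apply: val_inj => /=; rewrite xy vu wu.
have [I /fiber_cover_coloring[f [fp fI]]] := col_k foldK.
exists (fun u => (val (f u)).2); split=> // u.
by apply: (subsetP (BA u)); have := valP (f u); rewrite /= fp.
Qed.

End Restriction.

(** * Monotonicity in the list size and the upper bound *)

Lemma dp_colorable_leq (G : sgraph) (k k' : nat) :
  (k <= k')%N -> dp_colorable G k -> dp_colorable G k'.
Proof.
move=> kk' colk H Hk'.
have [//||f [fL fI]] :=
    @restricted_coloring G G H id k (cov_list H) (fun=> (fun=> id)) _ _ colk.
  by move=> u; rewrite Hk'.
by exists [set f v | v in [set: G]]; apply: transversal_coloring.
Qed.

Lemma chi_DP_colorable (G : sgraph) : dp_colorable G (chi_DP G).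
Proof. by rewrite /chi_DP; case: ex_minnP => n /asboolP. Qed.

Lemma chi_DP_eq (G : sgraph) (n : nat) :
  dp_colorable G n.+1 -> ~ dp_colorable G n -> chi_DP G = n.+1.
Proof.
move=> coln ncoln; apply/eqP; rewrite eqn_leq ltnNge; apply/andP; split.
  by rewrite /chi_DP; case: ex_minnP => m _; apply; apply/asboolP.
apply/negP=> len; apply: ncoln; exact: dp_colorable_leq len (@chi_DP_colorable G).
Qed.

Lemma cart_layer_edge (G K : sgraph) (u v : G) (x : K) :
  ((u, x) : G □ K) -- ((v, x) : G □ K) -> u -- v.
Proof. by rewrite /= /cart_rel /= sedge_irrefl eqxx andbF. Qed.

Lemma cart_bipartite_colorable (G : sgraph) (k l t : nat) :
  dp_colorable G k -> dp_colorable (G □ 'K_(l, t)) (k + l)%N.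
Proof.
move=> colk H foldH; set Gam := G □ 'K_(l, t).
have /choice[fL fLP] (i : 'I_l) : exists f : G -> H,
    (forall u, f u \in cov_list H ((u, inl i) : Gam)) /\ (forall u v, ~~ (f u -- f v)).
  apply: (@restricted_coloring G Gam H (fun u => (u, inl i)) k) => // [u v|u].
    exact: cart_layer_edge.
  by rewrite foldH leq_addr.
pose nb (j : 'I_t) (u : G) (i : 'I_l) :=
  [set y in cov_list H ((u, inr j) : Gam) | fL i u -- y].
have cardnb j u i : (#|nb j u i| <= 1)%N.
  apply/card_le1_eqP=> y z; rewrite !inE => /andP[yj xy] /andP[zj xz].
  exact: cov_list_nbr_inj ((fLP i).1 u) zj yj xz xy.
have /choice[fR fRP] (j : 'I_t) : exists f : G -> H,
    (forall u, f u \in cov_list H ((u, inr j) : Gam) :\: \bigcup_i nb j u i)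
    /\ (forall u v, ~~ (f u -- f v)).
  apply: (@restricted_coloring G Gam H (fun u => (u, inr j)) k) => // [u v|u|u].
  - exact: cart_layer_edge.
  - exact: subsetDl.
  rewrite cardsD foldH leq_subRL; last first.
    by rewrite -(foldH (u, inr j)) subset_leq_card // subsetIl.
  rewrite addnC leq_add2l; apply: leq_trans (subset_leq_card (subsetIr _ _)) _.
  apply: leq_trans (_ : \sum_(i < l) 1 <= l)%N; last by rewrite sum1_card card_ord.
  elim/big_ind2: _ => [|A a B b Aa Bb|i _]; rewrite ?cards0 //.
  exact: leq_trans (leq_card_setU _ _) (leq_add Aa Bb).
pose F (w : Gam) : H := match w.2 with inl i => fL i w.1 | inr j => fR j w.1 end.
have FL w : F w \in cov_list H w.
  case: w => u [i|j]; rewrite /F /=; first exact: (fLP i).1.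
  by have := (fRP j).1 u; rewrite inE => /andP[].
(* An edge between a left and a right copy lies over a single vertex of [G], where the right colour
   was picked outside [nb]. *)
have cross u v i j : ~~ (fL i u -- fR j v).
  apply/negP=> e; have /= := cov_list_edge (FL (u, inl i)) (FL (v, inr j)) e.
  rewrite /cart_rel /= andbT orbF => /eqP uv; rewrite -{v}uv in e.
  have := (fRP j).1 u; rewrite inE => /andP[/bigcupP[]].
  by exists i => //; rewrite inE e (FL (u, inr j)).
exists [set F v | v in [set: Gam]]; apply: transversal_coloring => // u v.
apply/negP=> e; case: u v e => u [i|j] [v [i'|j']] e.
- have := cov_list_edge (FL _) (FL _) e; rewrite /= /cart_rel /= andbF /=.
  case/andP=> /eqP[ii'] _; rewrite -ii' in e.
  by have := (fLP i).2 u v; rewrite e.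
- by have := cross u v i j'; rewrite e.
- by rewrite sedge_sym in e; have := cross v u i' j; rewrite e.
- have := cov_list_edge (FL _) (FL _) e; rewrite /= /cart_rel /= andbF /=.
  case/andP=> /eqP[jj'] _; rewrite -jj' in e.
  by have := (fRP j).2 u v; rewrite e.
Qed.

(** * Translation covers and families of translates *)

Section ShiftCover.
Variables (G : sgraph) (A : finZmodType) (w : G -> G -> A).
Hypothesis w_anti : forall u v, w v u = - w u v.

(** The matching from [u] to [v] is translation by [w u v]; [w_anti] makes the one from [v] to [u]
    its inverse. *)
Definition shift_rel : rel (G * A) :=
  fun x y => (x.1 -- y.1) && (y.2 == x.2 + w x.1 y.1).

Lemma shift_sym : symmetric shift_rel.
Proof.
move=> x y; rewrite /shift_rel sedge_sym w_anti; congr (_ && _).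
by rewrite eq_sym subr_eq eq_sym.
Qed.

Lemma shift_proj x y : shift_rel x y -> x.1 -- y.1.
Proof. by case/andP. Qed.

Lemma shift_inj x y z : shift_rel x y -> shift_rel x z -> y.1 = z.1 -> y = z.
Proof.
case: x y z => [u a] [v b] [v' c]; rewrite /shift_rel /=.
by move=> /andP[_ /eqP->] /andP[_ /eqP->] ->.
Qed.

Definition shift_cover : dp_cover G := fiber_cover shift_sym shift_proj shift_inj.

Lemma shift_cover_fold : fold_cover #|A| shift_cover.
Proof.
move=> v; rewrite -cardsT -(card_imset [set: A] (f := fun a => (v, a))); last first.
  by move=> a b [].
apply: eq_card => -[u a]; rewrite inE /=; apply/eqP/imsetP => [->|[b _ [->]]] //.
by exists a.
Qed.

Lemma shift_cover_coloring (I : {set shift_cover}) : cover_coloring I ->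
  exists f : G -> A, forall u v, u -- v -> f v != f u + w u v.
Proof.
case/fiber_cover_coloring => F [Fp FI]; exists (fun v => (F v).2) => u v uv.
by have := FI u v; rewrite /shift_rel !Fp uv.
Qed.

End ShiftCover.

(* Greedy: on average over s, translation by s catches a proportion |D| / |A| of
   the elements not yet caught. *)
Lemma translates_cover (A : finZmodType) (D : {set A}) (c : nat) :
  exists S : seq A, size S = c /\
    (#|[set a : A | all (fun s => (a + s)%R \notin D) S]| * #|A| ^ c <=
     #|A| * #|~: D| ^ c)%N.
Proof.
elim: c => [|c [S [szS IH]]].
  by exists [::]; rewrite !expn0 !muln1 max_card.
pose U := [set a : A | all (fun s => (a + s)%R \notin D) S].
pose U' s := [set a in U | (a + s)%R \notin D].
(* Double counting of pairs: for each [a] in [U], exactly [#|~: D|] translations [s] send [a]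
   outside [D]. The minimising [s] below is then at most the average. *)
have sumU : (\sum_(s : A) #|U' s| = #|U| * #|~: D|)%N.
  transitivity (\sum_(s : A) \sum_(a in U) (a + s \notin D)%R)%N.
    apply: eq_bigr => s _; rewrite -sum1_card big_mkcond [RHS]big_mkcond /=.
    by apply: eq_bigr => a _; rewrite !inE; case: (all _ _) => //=; case: (_ \in D).
  rewrite exchange_big /= -sum_nat_const; apply: eq_bigr => a _.
  rewrite -(card_imset (~: D) (addIr (- a))) -sum1_card big_mkcond [RHS]big_mkcond /=.
  apply: eq_bigr => s _.
  rewrite (_ : (s \in _) = (a + s \notin D)); first by case: (_ \in D).
  apply/imsetP/idP => [[b]|sD]; last by exists (a + s); rewrite ?inE // addrC addKr.
  by rewrite inE => bD ->; rewrite addrC subrK.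
have [s Us] : exists s, (#|A| * #|U' s| <= #|U| * #|~: D|)%N.
  have [s _ smin] := @arg_minnP A 0 xpredT (fun s => #|U' s|) isT; exists s.
  by rewrite -sumU -sum_nat_const; apply: leq_sum => a _; apply: smin.
exists (s :: S); split; first by rewrite /= szS.
rewrite (_ : [set a | _] = U' s); last first.
  by apply/setP=> a; rewrite !inE /= andbC.
rewrite !expnS mulnCA mulnA (leq_trans (leq_mul Us (leqnn _))) //.
by rewrite mulnAC [X in (_ <= X)%N]mulnCA [X in (_ <= X)%N]mulnC leq_mul2r IH orbT.
Qed.

(** Joins pointwise addition with finiteness, so that tuples form a [finZmodType] and
    [translates_cover] applies to them. *)
HB.instance Definition _ (I : finType) (A : finZmodType) :=
  GRing.Zmodule.on {ffun I -> A}.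

(** The numerical hypothesis is m^l (1 - q)^c <= 1 with denominators cleared, for m = [p.+2]; this
    form of m provides a ring with 1 distinct from 0. *)
Lemma injective_translates (l p c : nat) :
  (0 < l)%N -> (p.+2 ^ l * (p.+2 ^ l - p.+2 ^_ l) ^ c <= (p.+2 ^ l) ^ c)%N ->
  exists S : seq {ffun 'I_l -> 'I_p.+2}, size S = c /\
    forall a, exists2 s, s \in S & injective (a + s).
Proof.
move=> l0 hc; pose D := [set a : {ffun 'I_l -> 'I_p.+2} | injectiveb a].
have [S [szS]] := translates_cover D c.
set U := [set a | _]; rewrite [#|~: D|]cardsCs setCK card_ffun !card_ord.
have -> : #|D| = (p.+2 ^_ l)%N by rewrite /D card_inj_ffuns !card_ord.
move=> hU; have {hU hc} U1 : (#|U| <= 1)%N.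
  rewrite -(leq_pmul2r (m := (p.+2 ^ l) ^ c)) ?expn_gt0 //.
  by rewrite mul1n (leq_trans hU).
exists S; split=> // a.
have [aU|] := boolP (a \in U); last first.
  by rewrite inE -has_predC => /hasP[s sS]; rewrite /= inE negbK => /injectiveP; exists s.
(* U is stable under adding a constant, so a second element is at hand. *)
have bU : a + [ffun=> 1] \in U.
  move: aU; rewrite !inE => /allP aS; apply/allP=> s /aS; apply: contra.
  rewrite !inE => /injectiveP inj; apply/injectiveP=> i j ij; apply: inj.
  by move: ij; rewrite !ffunE ![a _ + 1 + _]addrAC => ->.
have /ffunP/(_ (Ordinal l0)) := card_le1_eqP U1 _ _ aU bU.
by rewrite !ffunE => /eqP; rewrite -subr_eq0 addrAC subrr add0r oner_eq0.
Qed.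

(** * Proper colourings up to translation *)

Section ColoringOrbits.
Variables (G : sgraph) (u0 : G) (p : nat).

Definition based_coloring : {set {ffun G -> 'I_p.+2}} :=
  [set g | proper_coloring g & g u0 == 0].

Lemma proper_coloring_shift (f : {ffun G -> 'I_p.+2}) (a : 'I_p.+2) :
  proper_coloring [ffun u => f u + a] = proper_coloring f.
Proof.
apply: eq_forallb => u; apply: eq_forallb => v.
by rewrite !ffunE (inj_eq (addIr _)).
Qed.

(** A proper colouring [f] is in a unique way a based one plus a constant, namely [f u0]. *)
Lemma chrom_poly_based : chrom_poly G p.+2 = (#|based_coloring| * p.+2)%N.
Proof.
rewrite -[X in (_ * X)%N](card_ord p.+2) -cardsT -cardsX.
pose h (x : {ffun G -> 'I_p.+2} * 'I_p.+2) := [ffun u => x.1 u + x.2].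
rewrite -(@card_in_imset _ _ h) => [|[f a] [g b]]; last first.
  rewrite !inE /= !andbT => /andP[_ /eqP f0] /andP[_ /eqP g0] /ffunP fg.
  have ab : a = b by have := fg u0; rewrite !ffunE /= f0 g0 !add0r.
  by congr pair => //; apply/ffunP=> u; have := fg u; rewrite !ffunE /= ab => /addIr.
apply: eq_card => f; rewrite inE; apply/idP/imsetP => [fP|[[g a]]]; last first.
  by rewrite !inE => /andP[/andP[gP _] _] ->; rewrite proper_coloring_shift.
exists ([ffun u => f u + - f u0], f u0).
  by rewrite !inE proper_coloring_shift fP ffunE subrr eqxx.
by apply/ffunP=> u; rewrite !ffunE /= subrK.
Qed.

End ColoringOrbits.

(** * The lower bound: a cover without colouring *)

Lemma colorable_avoid (G : sgraph) (A : finType) (f : G -> A) (B : {set A}) :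
  (forall u v, u -- v -> f u != f v) -> (forall u, f u \notin B) ->
  colorable G (#|A| - #|B|).
Proof.
move=> fP fB; rewrite -(cardsC B) addKn.
have fBc u : f u \in ~: B by rewrite inE.
apply/existsP; exists [ffun u => enum_rank_in (fBc u) (f u)].
apply/forallP=> u; apply/forallP=> v; apply/implyP=> uv; rewrite !ffunE.
apply: contra (fP u v uv) => /eqP e; apply/eqP.
apply: (@enum_rank_in_inj _ _ _ _ (fBc u) (fBc v)) => //.
Qed.

(** Labels the right copies so that every required label occurs; copies in excess receive the
    default [x0], which handles all larger [t]. *)
Lemma exists_nth_onto (T : eqType) (s : seq T) (t : nat) (x0 : T) :
  (size s <= t)%N -> exists h : 'I_t -> T, forall x, x \in s -> exists j, h j = x.
Proof.
move=> st; exists (fun j => nth x0 s j) => x xs.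
have jt : (index x s < t)%N by rewrite (leq_trans _ st) // index_mem.
by exists (Ordinal jt); rewrite nth_index.
Qed.

Lemma cart_bipartite_not_colorable (G : sgraph) (u0 : G) (l p c t : nat) :
  (0 < l)%N -> ~~ colorable G (p.+2 - l) ->
  (p.+2 ^ l * (p.+2 ^ l - p.+2 ^_ l) ^ c <= (p.+2 ^ l) ^ c)%N ->
  (c * chrom_poly G p.+2 ^ l <= t * p.+2 ^ l)%N ->
  ~ dp_colorable (G □ 'K_(l, t)) p.+2.
Proof.
move=> l0 ncol hc.
rewrite (chrom_poly_based u0) expnMn mulnA leq_pmul2r ?expn_gt0 // => ht.
have [S [szS SP]] := injective_translates l0 hc.
pose gs := enum [set g : {ffun 'I_l -> {ffun G -> 'I_p.+2}} |
  [forall i, g i \in based_coloring u0 p]].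
have szgs : size gs = (#|based_coloring u0 p| ^ l)%N.
  rewrite -cardE -[X in (_ ^ X)%N](card_ord l) -card_ffun_on.
  by apply: eq_card => g; rewrite inE; apply/forallP/ffun_onP.
have [|h hP] := @exists_nth_onto _ [seq (s, g) | s <- S, g <- gs] t (0, 0).
  by rewrite size_allpairs szS szgs.
pose sh (u : G) i j : 'I_p.+2 := (h j).1 i - (h j).2 i u.
(* The last case includes the edges inside a copy of [G], where the matching is the identity; the
   sign in the second makes [w] antisymmetric. *)
pose w (x y : G □ 'K_(l, t)) : 'I_p.+2 :=
  match x.2, y.2 with
  | inl i, inr j => sh x.1 i j
  | inr j, inl i => - sh y.1 i j
  | _, _ => 0
  end.
have w_anti x y : w y x = - w x y.
  by case: x y => [u [i|j]] [v [i'|j']]; rewrite /w /= ?oppr0 ?opprK.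
have foldS : fold_cover p.+2 (shift_cover w_anti).
  by rewrite -[X in fold_cover X](card_ord p.+2); apply: shift_cover_fold.
move=> /(_ _ foldS)[I /shift_cover_coloring[f fP]].
have layer x u v : u -- v -> f (u, x) != f (v, x).
  move=> uv; have := fP (u, x) (v, x); rewrite /= /cart_rel /= eqxx uv orbT.
  by rewrite eq_sym /w /=; case: x => ? /(_ isT); rewrite addr0.
pose a : {ffun 'I_l -> 'I_p.+2} := [ffun i => f (u0, inl i)].
pose g : {ffun 'I_l -> {ffun G -> 'I_p.+2}} := [ffun i => [ffun u => f (u, inl i) - a i]].
have [s sS sinj] := SP a.
have [|j hj] := hP (s, g).
  apply: allpairs_f => //; rewrite mem_enum inE; apply/forallP=> i.
  rewrite inE !ffunE subrr eqxx andbT.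
  apply/forallP=> u; apply/forallP=> v; apply/implyP=> uv.
  by rewrite !ffunE (inj_eq (addIr _)) layer.
apply/negP: ncol; rewrite negbK.
have -> : (p.+2 - l = #|'I_p.+2| - #|[set (a + s)%R i | i : 'I_l]|)%N.
  by rewrite card_imset // !card_ord.
apply: (@colorable_avoid _ _ (fun u => f (u, inr j))) => [u v|u]; first exact: layer.
(* At [u] the i-th left copy forbids f(u, i) + s_i - g_i(u), which equals a_i + s_i because g_i(u) =
   f(u, i) - a_i. *)
apply/imsetP=> -[i _ fu].
have := fP (u, inl i) (u, inr j); rewrite /= /cart_rel /= eqxx /= => /(_ isT).
by rewrite fu /w /= /sh hj /= !ffunE opprB addrCA [f (u, _) + _]addrC subrK addrC eqxx.
Qed.

(** * Estimates for the logarithm *)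

Section LnBounds.
Variable R : realType.
Implicit Types x y q : R.

(** The function ln x + 4 / (x + 1) equals 2 at 1, and its derivative (x - 1)^2 / (x (x + 1)^2) is
    nonnegative for x >= 1. *)
Lemma ln_ge_rational y : 1 <= y -> 2 - 4 / (y + 1) <= ln y.
Proof.
move=> y1; pose f x := ln x + 4 * (x + 1)^-1.
have df x : 1 <= x -> is_derive x 1 f (x^-1 - 4 * (x + 1) ^- 2).
  move=> x1; have x0 : 0 < x by lra.
  have x10 : x + 1 != 0 by rewrite gt_eqF //; lra.
  have dln := is_derive1_ln x0.
  rewrite /f; apply: is_derive_eq; rewrite !(scaler0, addr0).
  by rewrite /GRing.scale /= mulr1 mulrN.
have [||z] := MVT_segment (f := f) (df := fun x => x^-1 - 4 * (x + 1) ^- 2) y1.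
- by move=> x /itvP xy; apply: df; rewrite ltW // xy.
- apply: derivable_within_continuous => x /itvP xy.
  by have [] := df x _; rewrite ?xy.
rewrite in_itv /= => /andP[z1 zy] fy.
suff : 0 <= (z^-1 - 4 * (z + 1) ^- 2) * (y - 1).
  have f1 : 4 * (1 + 1)^-1 = 2 :> R by field.
  by rewrite -fy /f ln1 f1; lra.
have z0 : 0 < z by exact: lt_le_trans ltr01 z1.
rewrite mulr_ge0 ?subr_ge0 // ler_pdivrMr ?exprn_gt0 ?addr_gt0 //.
rewrite mulrC ler_pdivlMr //.
by have := sqr_ge0 (z - 1); rewrite !expr2; lra.
Qed.

Lemma inv_ln_gap q : 0 < q < 1 -> (- ln (1 - q))^-1 <= q^-1 - 2^-1.
Proof.
(* The rational bound is taken at y = 1 / (1 - q), where it equals 2q / (2 - q), the inverse of 1/q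
   - 1/2. *)
case/andP=> q0 q1.
have y1 : 1 <= (1 - q)^-1 by rewrite invf_ge1; lra.
have := ln_ge_rational y1; rewrite lnV ?posrE; last by lra.
have -> : 2 - 4 / ((1 - q)^-1 + 1) = (q^-1 - 2^-1)^-1.
  field; rewrite ?gt_eqF; lra.
move=> h; rewrite -[leRHS]invrK lef_pV2 ?posrE //.
  by rewrite oppr_gt0 ln_lt0; lra.
by rewrite invr_gt0 subr_gt0 ltf_pV2 ?posrE; lra.
Qed.

Lemma ceil_div_ln_le q x : 0 < q < 1 -> 2 <= x ->
  (Num.ceil (x / - ln (1 - q)))%:~R <= x / q.
Proof.
move=> q01 x2; have := ceilB1_lt (x / - ln (1 - q)); rewrite intrB.
have := ler_wpM2l (le_trans (ler0n _ _) x2) (inv_ln_gap q01).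
by rewrite mulrBr; lra.
Qed.

Lemma expr_ceil_div_ln_le q x (c : nat) : 0 < q < 1 -> 0 < x ->
  c = `|Num.ceil (ln x / - ln (1 - q))|%N -> x * (1 - q) ^+ c <= 1.
Proof.
move=> /andP[q0 q1] x0 ec.
have p0 : 0 < 1 - q by lra.
have lnq : 0 < - ln (1 - q) by rewrite oppr_gt0 ln_lt0; lra.
have : ln x / - ln (1 - q) <= c%:R.
  apply: le_trans (ceil_ge _) _; rewrite ec -[X in _ <= X]pmulrn natr_absz ler_int.
  exact: ler_norm.
rewrite ler_pdivrMr // mulrN -mulr_natl => h.
rewrite -ler_ln ?posrE ?mulr_gt0 ?exprn_gt0 // ln1.
by rewrite lnM ?posrE ?exprn_gt0 // lnXn // -[ln _ *+ _]mulr_natl; lra.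
Qed.

End LnBounds.

(** * The constant [c_kl] in terms of the proportion of injective tuples *)

Section CoverSize.
Variables (R : realType) (k l : nat).
Hypotheses (hk : (2 <= k)%N) (hl : (2 <= l)%N).
Let m := (k + l - 1)%N.
Let q : R := (m ^_ l)%:R / m%:R ^+ l.

(** A constant tuple is not injective, so injective tuples form a proper subset. *)
Lemma ffact_expn_lt (n j : nat) : (1 < n)%N -> (1 < j)%N -> (n ^_ j < n ^ j)%N.
Proof.
move=> n1 j1.
pose D := [set a : {ffun 'I_j -> 'I_n} | injectiveb a].
have -> : (n ^_ j = #|D|)%N by rewrite /D card_inj_ffuns !card_ord.
have -> : (n ^ j = #|[set: {ffun 'I_j -> 'I_n}]|)%N by rewrite cardsT card_ffun !card_ord.
apply: proper_card; rewrite properT; apply/negP=> /eqP DT.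
have : [ffun=> Ordinal (ltnW n1)] \in D by rewrite DT.
rewrite inE => /injectiveP/(_ (Ordinal (ltnW j1)) (Ordinal j1)).
by rewrite !ffunE => /(_ erefl)/(congr1 val).
Qed.

Lemma ratio01 : 0 < q < 1.
Proof.
have m0 : 0 < m%:R ^+ l :> R by rewrite exprn_gt0 // ltr0n /m; lia.
rewrite /q divr_gt0 // ?ltr0n ?ffact_gt0 /= ?ltr_pdivrMr ?mul1r //;
  last by rewrite /m; lia.
by rewrite -natrX ltr_nat ffact_expn_lt // /m; lia.
Qed.

Lemma ffactM_fact : (m ^_ l * (k - 1)`! = m`!)%N.
Proof.
by rewrite -(@ffact_fact m l); first congr (_ * _`!)%N; rewrite /m; lia.
Qed.

(** Since m! = [m ^_ l] (k - 1)!, the last logarithm in [c_kl] has argument (k - 1)! m^l (1 - q);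
    the first two terms of the denominator cancel against it and leave - ln (1 - q). *)
Lemma c_klE : c_kl R k l = Num.ceil (ln (m%:R ^+ l) / - ln (1 - q)).
Proof.
have [q0 q1] := andP ratio01.
have m0 : 0 < m%:R :> R by rewrite ltr0n /m; lia.
have f0 : 0 < ((k - 1)`!)%:R :> R by rewrite ltr0n fact_gt0.
have ml0 : 0 < m%:R ^+ l :> R by rewrite exprn_gt0.
rewrite /c_kl -/m lnXn // -[ln _ *+ _]mulr_natl; congr (Num.ceil (_ / _)).
have -> : ((k - 1)`!)%:R * m%:R ^+ l - (m`!)%:R
    = ((k - 1)`!)%:R * (m%:R ^+ l * (1 - q)) :> R.
  by rewrite -ffactM_fact natrM /q; field; rewrite gt_eqF.
rewrite lnM ?posrE ?mulr_gt0 ?subr_gt0 // [ln (_ * (1 - q))]lnM ?posrE ?subr_gt0 //.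
by rewrite lnXn // -[ln _ *+ _]mulr_natl; ring.
Qed.

Lemma c_kl_count (c : nat) : c = `|c_kl R k l|%N ->
  (m ^ l * (m ^ l - m ^_ l) ^ c <= (m ^ l) ^ c)%N.
Proof.
have m0 : 0 < m%:R ^+ l :> R by rewrite exprn_gt0 // ltr0n /m; lia.
have ffm : (m ^_ l <= m ^ l)%N by rewrite ltnW // ffact_expn_lt // /m; lia.
rewrite c_klE => /(expr_ceil_div_ln_le ratio01 m0).
have -> : 1 - q = (m ^ l - m ^_ l)%:R / m%:R ^+ l.
  by rewrite natrB // natrX /q; field; rewrite gt_eqF.
rewrite expr_div_n mulrA ler_pdivrMr ?mul1r; last exact: exprn_gt0.
by rewrite -!natrX -natrM ler_nat -?natrX.
Qed.

Lemma c_kl_ge0 : (0 <= c_kl R k l)%R.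
Proof.
rewrite c_klE ceil_ge0; apply: lt_le_trans (ltrN10 _) _.
have [q0 q1] := andP ratio01.
rewrite divr_ge0 ?ln_ge0 ?exprn_ege1 ?ler1n //; first by rewrite /m; lia.
by rewrite oppr_ge0 ln_le0; lra.
Qed.

Lemma c_kl_le :
  (c_kl R k l)%:~R <= l%:R * ((k - 1)`!)%:R * ln m%:R / (m`!)%:R * m%:R ^+ l :> R.
Proof.
have m0 : 0 < m%:R :> R by rewrite ltr0n /m; lia.
have ml0 : 0 < m%:R ^+ l :> R by rewrite exprn_gt0.
have f0 : 0 < ((k - 1)`!)%:R :> R by rewrite ltr0n fact_gt0.
have ff0 : 0 < (m ^_ l)%:R :> R by rewrite ltr0n ffact_gt0 /m; lia.
rewrite c_klE; apply: le_trans (ceil_div_ln_le ratio01 _) _; last first.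
  rewrite lnXn // -[ln _ *+ _]mulr_natl -ffactM_fact natrM /q
    le_eqVlt.
  by apply/orP; left; apply/eqP; field; rewrite !gt_eqF.
rewrite lnXn // -[ln _ *+ _]mulr_natl.
(* From m >= 3 the rational bound gives ln m >= 2 - 4/4 = 1, hence l ln m >= 2, as [ceil_div_ln_le]
   requires. *)
have ln3 : 1 <= ln m%:R :> R.
  apply: le_trans (ln_ge_rational _); last by rewrite ler1n /m; lia.
  have m3 : 3 <= m%:R :> R by rewrite (ler_nat _ 3) /m; lia.
  by rewrite lerBrDr -lerBrDl ler_pdivrMr; lra.
have l2 : 2 <= l%:R :> R by rewrite (ler_nat _ 2).
by rewrite -[2]mulr1 ler_pM.
Qed.

End CoverSize.

(** * Assembly of both bounds *)

Lemma not_colorable_lt_chi (G : sgraph) (n : nat) : (n < chi G)%N -> ~~ colorable G n.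
Proof.
rewrite /chi; case: ex_minnP => c _ cmin; rewrite ltnNge.
by apply: contra => /cmin.
Qed.

Lemma chi_DP_cart_bipartite (R : realType) (k l t : nat) (G : sgraph) :
  (2 <= k)%N -> (2 <= l)%N -> (0 < #|G|)%N -> chi G = k -> chi_DP G = k ->
  (c_kl R k l)%:~R * ((chrom_poly G (k + l - 1))%:R / (k + l - 1)%:R) ^+ l
    <= t%:R :> R ->
  chi_DP (G □ 'K_(l, t)) = (k + l)%N.
Proof.
move=> k2 l2 /card_gt0P[u0 _] chik chiDPk ht.
have [p Ep] : exists p, (k + l - 1 = p.+2)%N by exists (k + l - 3)%N; lia.
have -> : (k + l = p.+3)%N by lia.
apply: chi_DP_eq.
  have -> : (p.+3 = k + l)%N by lia.
  by apply: cart_bipartite_colorable; rewrite -chiDPk; apply: chi_DP_colorable.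
apply: (@cart_bipartite_not_colorable _ u0 _ _ `|c_kl R k l|%N); first by lia.
(* Removing l of the k + l - 1 colours leaves k - 1, one fewer than [chi G]. *)
- by apply: not_colorable_lt_chi; lia.
- by rewrite -Ep; apply: c_kl_count.
rewrite -(ler_nat R) !natrM !natrX -ler_pdivrMr ?exprn_gt0 ?ltr0n // -mulrA -expr_div_n.
rewrite -Ep [_%:R in X in X <= _](_ : _ = (c_kl R k l)%:~R) //.
by rewrite natr_absz ger0_norm // c_kl_ge0.
Qed.

Theorem theorem1p11 (R : realType) (k l : nat) (G : sgraph)
    (hk : (2 <= k)%N) (hG : (0 < #|G|)%N)
    (hcrit : critical k G) (hDP : chi_DP G = k) (hl : (2 <= l)%N) :
  (forall t : nat,
     (c_kl R k l)%:~R * ((chrom_poly G (k + l - 1))%:R / (k + l - 1)%:R) ^+ l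
       <= t%:R :> R ->
     chi_DP (G □ 'K_(l, t)) = (k + l)%N)
  /\
  (forall t : nat,
     (l%:R * ((k - 1)`!)%:R * ln (k + l - 1)%:R / ((k + l - 1)`!)%:R)
       * (chrom_poly G (k + l - 1))%:R ^+ l <= t%:R :> R ->
     chi_DP (G □ 'K_(l, t)) = (k + l)%N).
Proof.
have [chik _] := hcrit.
split=> t ht; apply: (@chi_DP_cart_bipartite R) => //.
apply: le_trans ht; have c_le := c_kl_le R hk hl.
have m0 : 0 < ((k + l - 1)%:R : R) by rewrite ltr0n; lia.
(* The factor m^l in the bound on [c_kl] cancels the denominator of (P(G, m) / m)^l. *)
apply: le_trans (ler_wpM2r _ c_le) _; first by rewrite exprn_ge0 // divr_ge0.
rewrite expr_div_n -[X in X <= _]mulrA.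
by rewrite [(_ ^+ l) * (_ / _)]mulrC divfK ?expf_neq0 ?gt_eqF.
Qed.
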